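(* For any finite POMDP as in the context, any policy $\mu\in\mathcal P$ and any integer $T\ge0$, $$H_\mu(Y^T,U^{T-1})=H_\mu(Y^T\|U^{T-1})+H_\mu(U^{T-1}\|Y^{T-1}).$$
   Context: Logarithms are base 2, $0\log0=0$, empty sums are $0$ and empty products are $1$. Superscripts denote trajectories: $X^T=(X_0,\dots,X_T)$, and similarly for $Y^T$, $U^{T-1}$; $U^{-1}$ and $Y^{-1}$ are empty. POMDP: finite sets $\mathcal X=\{1,\dots,N_x\}$ (states), $\mathcal U=\{1,\dots,N_u\}$ (controls), $\mathcal Y=\{1,\dots,N_y\}$ (observations); initial pmf $\rho$ of $X_0$ on $\mathcal X$; transition kernel $A^{x,\bar x}(u)=p(X_{k+1}=x\mid X_k=\bar x,U_k=u)$; observation kernel $B^{x,y}(u)=p(Y_k=y\mid X_k=x,U_{k-1}=u)$ for $k>0$ and $B^{x_0,y_0}=p(Y_0=y_0\mid X_0=x_0)$. A policy is $\mu=\{\mu_k^{i_k}:k\ge0\}$, where for each $i_k=(y^k,u^{k-1})$, $\mu_k^{i_k}(u_k)=p(U_k=u_k\mid Y^k=y^k,U^{k-1}=u^{k-1})$ is a pmf on $\mathcal U$ (possibly non-degenerate); $\mathcal P$ is the set of all policies. Under $\mu$, $$p_\mu(x^T,y^T,u^{T-1})=\rho(x_0)B^{x_0,y_0}\prod_{k=0}^{T-1}A^{x_{k+1},x_k}(u_k)\,\mu_k^{i_k}(u_k)\,B^{x_{k+1},y_{k+1}}(u_k),$$ and $H_\mu$ denotes (conditional) Shannon entropy under this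 law. In particular the input-output entropy is $H_\mu(Y^T,U^{T-1})=-E_\mu[\log p_\mu(Y^T,U^{T-1})]$. Causally conditioned entropies: $H_\mu(Y^T\|U^{T-1})\triangleq\sum_{k=0}^TH_\mu(Y_k\mid Y^{k-1},U^{k-1})$, with the $k=0$ term equal to $H(Y_0)$; and $H_\mu(U^{T-1}\|Y^{T-1})\triangleq\sum_{k=0}^{T-1}H_\mu(U_k\mid U^{k-1},Y^k)$, with the $k=0$ term equal to $H_\mu(U_0\mid Y_0)$ and $H_\mu(U^{-1}\|Y^{-1})\triangleq0$. *)

(* Defs.v *)
From HB Require Import structures.
From mathcomp Require Import all_boot all_order all_algebra.
From mathcomp Require Import reals exp.

Set Implicit Arguments.
Unset Strict Implicit.
Unset Printing Implicit Defensive.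

Import Order.TTheory GRing.Theory Num.Theory.
Local Open Scope ring_scope.

Section FiniteProbability.
Variable R : realType.

Definition log2 (x : R) : R := ln x / ln 2.

Definition is_pmf (A : finType) (p : A -> R) : Prop :=
  (forall a, 0 <= p a) /\ \sum_a p a = 1.

Variable W : finType.
Implicit Type p : W -> R.

Definition expectation p (Z : W -> R) : R := \sum_w p w * Z w.

(* The probability that the random variable [f] takes the value [a]. *)
Definition prob (A : finType) p (f : W -> A) (a : A) : R :=
  \sum_(w | f w == a) p w.

(* The law [p] conditioned on the event [g = b]; identically zero if that
   event has probability zero. *)
Definition cond_law (B : finType) p (g : W -> B) (b : B) : W -> R :=
  fun w => if g w == b then p w / prob p g b else 0.

(* H(f) = - E[log p(f)].  Outcomes of probability zero contribute zero,
   which is the convention 0 log 0 = 0. *)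
Definition entropy (A : finType) p (f : W -> A) : R :=
  - expectation p (fun w => log2 (prob p f (f w))).

(* H(f | g) = \sum_b P(g = b) H(f | g = b). *)
Definition cond_entropy (A B : finType) p (f : W -> A) (g : W -> B) : R :=
  \sum_b prob p g b * entropy (cond_law p g b) f.

End FiniteProbability.

(* Trajectories of length [n], indexed from 0. *)
Notation traj A n := {ffun 'I_n -> A}.

Definition prefix_traj (A : finType) (m n : nat) (le_mn : (m <= n)%N)
    (a : traj A n) : traj A m :=
  [ffun i => a (widen_ord le_mn i)].

Record pomdp (R : realType) (X U Y : finType) := Pomdp {
  init : X -> R;
  (* [trans x xbar u] = p(X_{k+1} = x | X_k = xbar, U_k = u) *)
  trans : X -> X -> U -> R;
  (* [obs0 x y] = p(Y_0 = y | X_0 = x) *)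
  obs0 : X -> Y -> R;
  (* [obs x y u] = p(Y_k = y | X_k = x, U_{k-1} = u) for k > 0 *)
  obs : X -> Y -> U -> R;
  init_pmf : is_pmf init;
  trans_pmf : forall xbar u, is_pmf (fun x => trans x xbar u);
  obs0_pmf : forall x, is_pmf (obs0 x);
  obs_pmf : forall x u, is_pmf (fun y => obs x y u)
}.

(* [act mu k y u v] = p(U_k = v | Y^k = y, U^{k-1} = u), where [y] has
   length k + 1 and [u] has length k. *)
Record policy (R : realType) (U Y : finType) := Policy {
  act : forall k : nat, traj Y k.+1 -> traj U k -> U -> R;
  act_pmf : forall k (y : traj Y k.+1) (u : traj U k), is_pmf (act y u)
}.

Section Model.
Variables (R : realType) (X U Y : finType).
Variables (M : pomdp R X U Y) (mu : policy R U Y) (T : nat).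

(* Outcomes (x^T, y^T, u^{T-1}). *)
Definition outcome : finType := (traj X T.+1 * traj Y T.+1 * traj U T)%type.

Definition xs (w : outcome) : traj X T.+1 := w.1.1.
Definition ys (w : outcome) : traj Y T.+1 := w.1.2.
Definition us (w : outcome) : traj U T := w.2.

(* For k < T: the time indices k and k + 1 in {0, ..., T}. *)
Definition now (k : 'I_T) : 'I_T.+1 := widen_ord (leqnSn T) k.
Definition next (k : 'I_T) : 'I_T.+1 := lift ord0 k.

(* For k < T: y^k (length k + 1), u^{k-1} (length k) and u^k (length k + 1). *)
Definition y_upto (k : 'I_T) (w : outcome) : traj Y k.+1 :=
  prefix_traj (ltnW (ltn_ord k) : (k.+1 <= T.+1)%N) (ys w).
Definition u_before (k : 'I_T) (w : outcome) : traj U k :=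
  prefix_traj (ltnW (ltn_ord k)) (us w).
Definition u_upto (k : 'I_T) (w : outcome) : traj U k.+1 :=
  prefix_traj (ltn_ord k) (us w).

Definition law (w : outcome) : R :=
  init M (xs w ord0) * obs0 M (xs w ord0) (ys w ord0) *
  \prod_(k < T)
    (trans M (xs w (next k)) (xs w (now k)) (us w k) *
     act mu (y_upto k w) (u_before k w) (us w k) *
     obs M (xs w (next k)) (ys w (next k)) (us w k)).

(* H_mu(Y^T, U^{T-1}) *)
Definition io_entropy : R := entropy law (fun w => (ys w, us w)).

(* H_mu(Y^T || U^{T-1}): the time-0 term is H(Y_0), and the summand of index k
   is the term H_mu(Y_{k+1} | Y^k, U^k) of time k + 1. *)
Definition causal_entropy_YU : R :=
  entropy law (fun w => ys w ord0) +
  \sum_(k < T) cond_entropy law (fun w => ys w (next k))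
                                (fun w => (y_upto k w, u_upto k w)).

(* H_mu(U^{T-1} || Y^{T-1}): the summand of index k is
   H_mu(U_k | U^{k-1}, Y^k), where U^{-1} is the empty trajectory. *)
Definition causal_entropy_UY : R :=
  \sum_(k < T) cond_entropy law (fun w => us w k)
                                (fun w => (u_before k w, y_upto k w)).

End Model.

(* Main.v *)
(** On the support of the law, conditioning gives H(f | g) = H(f, g) - H(g) and
    the entropy of a variable depends only on the partition of the sample space
    it induces.  Writing h(k) = H(Y^k, U^{k-1}), the two conditional entropies
    of index k therefore add up to h(k+1) - h(k), and the sum over k < T
    telescopes to h(T) - H(Y_0). *)
Require Import Defs.
From HB Require Import structures.
From mathcomp Require Import all_boot all_order all_algebra.
From mathcomp Require Import reals exp.

Import Order.TTheory GRing.Theory Num.Theory.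
Local Open Scope ring_scope.

Section FiniteEntropy.
Variables (R : realType) (W : finType) (p : W -> R).

Lemma log2_div (x y : R) : 0 < x -> 0 < y -> log2 (x / y) = log2 x - log2 y.
Proof. by move=> x0 y0; rewrite /log2 ln_div ?posrE// mulrBl. Qed.

(** Since [entropy] sums over outcomes rather than values, a variable enters only through the events
    [f w' = f w]. This lets tuples of variables be reordered and regrouped freely. *)
Lemma eq_entropy (A B : finType) (f : W -> A) (g : W -> B) :
  (forall w w', f w = f w' <-> g w = g w') -> entropy p f = entropy p g.
Proof.
move=> fg; congr (- _); apply: eq_bigr => w _; congr (_ * log2 _).
by apply: eq_bigl => w'; apply/eqP/eqP; apply fg.
Qed.

Hypothesis p_ge0 : forall w, 0 <= p w.

Lemma prob_gt0 (A : finType) (f : W -> A) (w : W) :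
  0 < p w -> 0 < prob p f (f w).
Proof.
move=> pw; rewrite /prob (bigD1 w)//=.
by rewrite ltr_wpDr// sumr_ge0.
Qed.

Lemma prob_cond_law (A B : finType) (f : W -> A) (g : W -> B) (a : A) (b : B) :
  prob (cond_law p g b) f a = prob p (fun w => (f w, g w)) (a, b) / prob p g b.
Proof.
rewrite /prob /cond_law -big_mkcondr /= mulr_suml.
by apply: eq_bigl => w; rewrite xpair_eqE.
Qed.

Lemma chain_rule (A B : finType) (f : W -> A) (g : W -> B) :
  cond_entropy p f g = entropy p (fun w => (f w, g w)) - entropy p g.
Proof.
(* [F w] is the contribution of the outcome [w] to the expectation of the log of P(f | g). *)
pose F w := p w * (log2 (prob p (fun w => (f w, g w)) (f w, g w))
                   - log2 (prob p g (g w))).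
have -> : cond_entropy p f g = \sum_b - \sum_(w | g w == b) F w.
  apply: eq_bigr => b _; rewrite /entropy /expectation mulrN mulr_sumr.
  rewrite [in RHS]big_mkcond; congr (- _); apply: eq_bigr => w _.
  rewrite prob_cond_law /cond_law /F; case: eqP => [<-|_]; last first.
    by rewrite mul0r mulr0.
  (* Outcomes of mass zero contribute zero on both sides; elsewhere both probabilities are positive,
     so the log of their quotient splits. *)
  have [->|pw_neq0] := eqVneq (p w) 0; first by rewrite !mul0r mulr0.
  have pw : 0 < p w by rewrite lt_def pw_neq0 p_ge0.
  have gw := prob_gt0 _ g w pw.
  rewrite log2_div//; last exact: (prob_gt0 _ (fun w => (f w, g w)) w pw).
  (* The weight P(g = b) cancels the normalization of the conditional law. *)
  by rewrite mulrA [_ * (p w / _)]mulrC divfK// gt_eqF.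
rewrite sumrN.
have <- : \sum_w F w = \sum_b \sum_(w | g w == b) F w.
  by rewrite (partition_big g predT).
rewrite /F; under eq_bigr do rewrite mulrBr.
by rewrite sumrB opprB /entropy /expectation opprK addrC.
Qed.

End FiniteEntropy.

Lemma prefix_traj_eq (A : finType) (m n : nat) (le_mn : (m <= n)%N)
    (a b : traj A n) :
  prefix_traj le_mn a = prefix_traj le_mn b <->
  (forall i : 'I_n, (i < m)%N -> a i = b i).
Proof.
split=> [/ffunP ab i im|ab].
  have := ab (Ordinal im); rewrite !ffunE.
  by rewrite (_ : widen_ord _ _ = i)//; apply: val_inj.
by apply/ffunP => i; rewrite !ffunE; apply: ab => /=.
Qed.

(** Used to split the last coordinate off an agreement of prefixes. *)
Lemma forall_ltnS (n k : nat) (P : 'I_n -> Prop) (j : 'I_n) : j = k :> nat ->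
  (forall i : 'I_n, (i < k.+1)%N -> P i) <->
  (forall i : 'I_n, (i < k)%N -> P i) /\ P j.
Proof.
move=> jk; split=> [H|[H Pj] i].
  by split=> [i ik|]; apply: H; rewrite ?jk// ltnW.
rewrite ltnS leq_eqVlt => /orP[/eqP ik|/H//].
by rewrite (_ : i = j)//; apply: val_inj; rewrite /= ik jk.
Qed.

Lemma pair_eq (A B : Type) (a a' : A) (b b' : B) :
  (a, b) = (a', b') <-> a = a' /\ b = b'.
Proof. by split=> [[-> ->]|[-> ->]]. Qed.

Section Model.
Variables (R : realType) (X U Y : finType).
Variables (M : pomdp R X U Y) (mu : policy R U Y) (T : nat).

Local Notation p := (@law R X U Y M mu T).

Lemma law_ge0 (w : outcome X U Y T) : 0 <= law M mu w.
Proof.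
rewrite /law mulr_ge0 ?prodr_ge0//.
  by rewrite mulr_ge0// ?(init_pmf M).1 ?(obs0_pmf M _).1.
move=> k _; rewrite !mulr_ge0//.
- exact: (trans_pmf M _ _).1.
- exact: (act_pmf mu _ _).1.
- exact: (obs_pmf M _ _).1.
Qed.

(* Truncating the lengths at T.+1 and T makes the prefix available at every k. *)
Definition io_prefix (k : nat) (w : outcome X U Y T) :=
  (prefix_traj (geq_minr k.+1 T.+1) (ys w), prefix_traj (geq_minr k T) (us w)).

Lemma io_prefix_eq (k : nat) (w w' : outcome X U Y T) :
  io_prefix k w = io_prefix k w' <->
  (forall i : 'I_T.+1, (i < k.+1)%N -> ys w i = ys w' i) /\
  (forall i : 'I_T, (i < k)%N -> us w i = us w' i).
Proof.
rewrite pair_eq !prefix_traj_eq.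
by split=> -[Hy Hu]; split=> i ik; (apply: Hy || apply: Hu);
  move: ik; rewrite leq_min ltn_ord andbT.
Qed.

(** By the chain rule, the two terms on the right are H(Y^{k+1}, U^k) - H(Y^k, U^k) and H(Y^k, U^k)
    - H(Y^k, U^{k-1}); the middle entropy cancels. *)
Lemma io_prefixS_entropy (k : 'I_T) :
  entropy p (io_prefix k.+1) - entropy p (io_prefix k) =
  cond_entropy p (fun w => ys w (Defs.next k))
                          (fun w => (y_upto k w, u_upto k w)) +
  cond_entropy p (fun w => us w k)
                          (fun w => (u_before k w, y_upto k w)).
Proof.
rewrite !(chain_rule _ _ _ law_ge0).
have -> : entropy p (io_prefix k.+1) =
    entropy p (fun w => (ys w (Defs.next k), (y_upto k w, u_upto k w))).
  apply: eq_entropy => w w'; rewrite io_prefix_eq !pair_eq !prefix_traj_eq.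
  by rewrite (forall_ltnS _ k.+1 _ (Defs.next k))//; tauto.
have -> : entropy p (io_prefix k) =
    entropy p (fun w => (u_before k w, y_upto k w)).
  apply: eq_entropy => w w'; rewrite io_prefix_eq !pair_eq !prefix_traj_eq.
  tauto.
have -> : entropy p (fun w => (us w k, (u_before k w, y_upto k w))) =
    entropy p (fun w => (y_upto k w, u_upto k w)).
  apply: eq_entropy => w w'; rewrite !pair_eq !prefix_traj_eq.
  by rewrite (forall_ltnS _ k _ k)//; tauto.
by rewrite addrA subrK.
Qed.

Lemma entropy_io_prefix0 :
  entropy p (io_prefix 0) = entropy p (fun w => ys w ord0).
Proof.
apply: eq_entropy => w w'; rewrite io_prefix_eq (forall_ltnS _ 0 _ ord0)//.
(* At k = 0 agreement of the controls is vacuous, and only the observation at time 0 remains. *)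
by split=> [[[]]|].
Qed.

Lemma entropy_io_prefixT :
  entropy p (io_prefix T) = io_entropy M mu T.
Proof.
apply: eq_entropy => w w'; rewrite io_prefix_eq pair_eq.
by split=> [[Hy Hu]|[-> ->]//]; split; apply/ffunP => i; rewrite ?Hy ?Hu.
Qed.

Lemma io_entropy_decomposition :
  io_entropy M mu T = causal_entropy_YU M mu T + causal_entropy_UY M mu T.
Proof.
rewrite /causal_entropy_YU /causal_entropy_UY -addrA -big_split /=.
under eq_bigr do rewrite -io_prefixS_entropy.
(* Telescoping needs a sum over natural numbers, which is possible because [io_prefix] is defined at
   every natural index. *)
rewrite -(big_mkord predT (fun k => entropy p (io_prefix k.+1)
                                  - entropy p (io_prefix k))).
rewrite telescope_sumr// entropy_io_prefixT entropy_io_prefix0.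
by rewrite addrC subrK.
Qed.

End Model.

Theorem mainTheorem4 (R : realType) (Nx Nu Ny : nat)
    (M : pomdp R 'I_Nx 'I_Nu 'I_Ny) (mu : policy R 'I_Nu 'I_Ny) (T : nat) :
  io_entropy M mu T =
  (causal_entropy_YU M mu T + causal_entropy_UY M mu T)%R.
Proof. exact: io_entropy_decomposition. Qed.
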